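(* Let $\eta_g(N)$ and $\tau$ be as defined in the context. Then $$\lim_{g \to \infty} \liminf_{N \to \infty} \frac{\eta_g(N)}{\sqrt{gN}}=\tau=\lim_{g \to \infty} \limsup_{N \to \infty} \frac{\eta_g(N)}{\sqrt{gN}}.$$
   Context: Write $[N]=\{1,2,\ldots,N\}$. For a set $A\subseteq \mathbb{Z}$ let $r_A(x)=|\{(a_1,a_2)\in A\times A : x=a_1-a_2\}|$. For natural numbers $g,N$, a set $A\subseteq\mathbb{Z}$ is a $g$-difference set for $[N]$ if $r_A(m)\ge g$ for all $m\in[N]$, and $\eta_g(N)$ is the minimum of $|A|$ over all $g$-difference sets $A$ for $[N]$. For functions $f:\mathbb{R}\to\mathbb{R}$ the autocorrelation is $(f\star f)(x)=\int_{\mathbb{R}} f(t)f(x+t)\,dt$. Let $\mathcal{F}$ be the set of functions $f:\mathbb{R}\to\mathbb{R}_{\ge 0}$ with $(f\star f)(x)\ge 1$ for all $x\in[0,1]$, and $\tau=\inf_{f\in\mathcal{F}}\int_{\mathbb{R}} f(x)\,dx$. *)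

(* Defs.v *)
From HB Require Import structures.
From mathcomp Require Import all_boot all_order all_algebra.
From mathcomp Require Import finmap.
From mathcomp Require Import all_classical all_reals all_analysis.

Set Implicit Arguments.
Unset Strict Implicit.
Unset Printing Implicit Defensive.

Import Order.TTheory GRing.Theory Num.Theory.
Import numFieldNormedType.Exports.

Local Open Scope classical_set_scope.
Local Open Scope ring_scope.

Definition diff_rep (A : {fset int}) (x : int) : nat :=
  #|` [fset p in (A `*` A)%fset | x == p.1 - p.2]%fset |.

Definition diff_set (g N : nat) (A : {fset int}) : Prop :=
  forall m : nat, (1 <= m <= N)%N -> (g <= diff_rep A m%:Z)%N.

Definition diff_set_size (g N : nat) : pred nat :=
  fun n => `[< exists2 A : {fset int}, diff_set g N A & #|` A|%fset = n >].

Lemma diff_set_size_ex (g N : nat) : exists n, diff_set_size g N n.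
Proof.
pose A : {fset int} := [fset k%:Z | k in iota 0 (N + g)]%fset.
exists #|` A|%fset; apply/asboolP; exists A => // m /andP[_ mN].
pose h (k : nat) : int * int := ((m + k)%N%:Z, k%:Z).
have hinj : injective h by move=> i j [_ ->].
pose B : {fset int * int} := [fset h k | k in iota 0 g]%fset.
have <- : #|` B|%fset = g.
  rewrite card_imfset //= undup_id ?iota_uniq //; exact: size_iota.
apply/fsubset_leq_card/fsubsetP => p /imfsetP[k /=].
rewrite mem_iota add0n => /andP[_ kg] ->.
rewrite !inE /= PoszD addrK eqxx andbT; apply/andP; split; apply/imfsetP.
  by exists (m + k)%N; rewrite //= mem_iota add0n -addnS leq_add.
by exists k; rewrite //= mem_iota add0n (leq_trans kg) ?leq_addl.
Qed.

Definition eta (g N : nat) : nat := ex_minn (diff_set_size_ex g N).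

Section tau.
Variable R : realType.

(* Borel measurability is the library default on [R]; [lebesgueR] is [R]
   equipped with the complete sigma-algebra of Lebesgue-measurable sets. *)
Definition lebesgueR := caratheodory_type ((wlength (@idfun R))^*)%mu.

Local Notation mu := (@completed_lebesgue_measure R).

Local Open Scope ereal_scope.

Definition autocorr (f : R -> R) (x : R) : \bar R :=
  \int[mu]_t (f t * f (x + t)%R)%:E.

Definition autocorr_class : set (R -> R) :=
  [set f | [/\ measurable_fun [set: lebesgueR] (f : lebesgueR -> R),
               (forall x, 0 <= f x)%R &
               forall x, x \in `[0%R, 1%R] -> 1 <= autocorr f x]].

Definition tau : \bar R :=
  ereal_inf [set \int[mu]_x (f x)%:E | f in autocorr_class].
End tau.

(* Main.v *)
Require Import Defs.
From mathcomp Require Import all_boot all_order all_algebra.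
From mathcomp Require Import finmap.
From mathcomp Require Import all_classical all_reals all_analysis.
From mathcomp Require Import measurable_realfun.
From mathcomp Require Import ring lra zify.
Set Implicit Arguments.
Unset Strict Implicit.
Unset Printing Implicit Defensive.
Import Order.TTheory GRing.Theory Num.Theory.
Import numFieldNormedType.Exports.
Local Open Scope classical_set_scope.
Local Open Scope ring_scope.

(** A [g]-difference set [A] for [[N]] gives the step function
    [sqrt (N / g) * \sum_(a in A) 1_[a/N, (a+1)/N[]. Its autocorrelation
    interpolates linearly between the values [r_A k / g], so it is at least 1 on
    [[0, 1]], while its integral is [#|A| / sqrt (g N)]: hence
    [tau <= eta g N / sqrt (g N)] for all positive [g] and [N].

    Conversely let [f] be admissible with integral close to [tau]. Fix a large
    odd prime [r], put [P = r ^ e], and choose levels [n_j]. In base [P], let [A]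
    consist of the integers with low digits [x], [y] and leading part [j] such that
    [(y - x ^ 2) mod P < n_j]. If [r] does not divide [d], then [x |-> (x + u)^2 - x^2]
    is a bijection mod [P] for the low digit [u] of [d], and [d] has at least
    [\sum_j n_j (min (n_(j+k), n_(j+k+1)) - 1)] representations, where
    [k = d / P ^ 2]. The multiples of [r] are covered by a further set of relative
    size [O(1 / sqrt r)]. The levels are rounded multiples of the integrals of [f]
    over overlapping windows of [s + 1] cells of length [1 / m]: averaging [f] over
    windows averages its autocorrelation, so the pointwise
    bound on the autocorrelation suffices, without any continuity. Powers of the single prime [r] are spaced by a bounded ratio,
    which is absorbed by letting [m] range over a bounded set fixed before [g]. *)

(** * Sets built from parabolas *)

Section parabola_sets.
Local Open Scope nat_scope.

Lemma leq_diff_rep (s : seq nat) (A : {fset int}) (d : nat) :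
  uniq s -> {in s, forall a : nat, (Posz a \in A) && (Posz (a + d) \in A)} ->
  size s <= diff_rep A d.
Proof.
move=> us sA; pose h (a : nat) : int * int := (Posz (a + d), Posz a).
have hinj : injective h by move=> i j [_ ->].
have -> : size s = #|` [fset h a | a in s]|%fset.
  by rewrite card_imfset //= undup_id.
apply/fsubset_leq_card/fsubsetP => p /imfsetP[a /= /sA /andP[aA adA] ->].
by rewrite !inE /= aA adA /=; apply/eqP; lia.
Qed.

Lemma card_fset_seq_le (s : seq nat) :
  #|` [fset Posz a | a in s]|%fset <= size s.
Proof. by rewrite card_imfset ?size_undup // => i j []. Qed.

Lemma modn_solve (P a b c : nat) : 0 < P -> coprime P a ->
  exists2 x, x < P & a * x + b = c %[mod P].
Proof.
move=> P0 aP; have [y _] := @Bezoutl P a P0; rewrite (eqP aP) => Pdiv.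
(* [y] is minus the inverse of [a] mod [P], and [P.-1 * c] stands for [- c] in [nat]. *)
exists ((y * (b + P.-1 * c)) %% P); first by rewrite ltn_mod.
apply/eqP; rewrite -modnDml modnMmr modnDml -(eqn_modDr (P.-1 * c)).
have -> : c + P.-1 * c = P * c by rewrite -mulSn prednK.
have -> : a * (y * (b + P.-1 * c)) + b + P.-1 * c
    = (1 + y * a) * (b + P.-1 * c) by lia.
rewrite modnMr; move: Pdiv; rewrite /dvdn => /eqP E.
by rewrite -modnMml E mul0n mod0n.
Qed.

Lemma euclid_inj (P x q x' q' : nat) : x < P -> x' < P ->
  x + P * q = x' + P * q' -> x = x' /\ q = q'.
Proof.
move=> xP x'P E; have P0 : 0 < P by apply: leq_ltn_trans xP.
have xx : x = x'.
  by have /(congr1 (modn^~ P)) := E; rewrite !(addnC _ (P * _)) !(mulnC P) !modnMDl !modn_small.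
by split => //; move: E; rewrite xx => /addnI /eqP; rewrite eqn_pmul2l // => /eqP.
Qed.

Lemma divn_carry (P z : nat) : z < 2 * P ->
  exists c x, [/\ z = x + P * c, x < P & c <= 1].
Proof.
by case: (ltnP z P) => zP z2; [exists 0, z|exists 1, (z - P)]; split; lia.
Qed.

Section parabola.
Variables (P H : nat) (n : nat -> nat).

(* In base P: low digits x and y = (i + x ^ 2) mod P, leading part j. *)
Definition parabola_elt (j x i : nat) := x + P * ((i + x ^ 2) %% P + P * j).

Definition parabola_seq :=
  [seq parabola_elt j (q %% P) (q %/ P) | j <- iota 0 H, q <- iota 0 (P * n j)].

Hypothesis P_gt0 : 0 < P.
Hypothesis n_le : forall j, n j <= P.
Hypothesis n_supp : forall j, H <= j -> n j = 0.

Lemma size_parabola_seq : size parabola_seq = P * \sum_(j < H) n j.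
Proof.
rewrite size_allpairs_dep big_distrr /= -(big_mkord xpredT (fun j => P * n j)).
rewrite /index_iota subn0 sumnE big_map.
by apply: eq_bigr => j _; rewrite size_iota.
Qed.

Lemma mem_parabola j x i : x < P -> i < n j -> parabola_elt j x i \in parabola_seq.
Proof.
move=> xP inj; have jH : j < H.
  by rewrite ltnNge; apply/negP => /n_supp E; rewrite E in inj.
apply/allpairsPdep; exists j, (i * P + x); split.
- by rewrite mem_iota.
- rewrite mem_iota add0n /=; apply: (@leq_trans (i.+1 * P)); last first.
    by rewrite mulnC leq_mul2l inj orbT.
  by rewrite mulSn addnC ltn_add2r.
- by rewrite modnMDl modn_small // divnMDl // divn_small // addn0.
Qed.

(* The carry out of the low digit raises the level i by at most 1 and the carry out of
   the middle digit raises the leading part by at most 1: whence .-1 and minn. *)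
Lemma parabola_shift j' x' i' i u v k : u < P -> v < P -> x' < P ->
  2 * u * x' + (u ^ 2 + i) = i' + v %[mod P] ->
  i < (minn (n (j' + k)) (n (j' + k + 1))).-1 ->
  parabola_elt j' x' i' + (u + P * (v + P * k)) \in parabola_seq.
Proof.
move=> uP vP x'P E Hi.
have [|c1 [x [xE xP c1le]]] := @divn_carry P (x' + u); first lia.
pose y' := (i' + x' ^ 2) %% P.
have y'P : y' < P by rewrite ltn_mod.
have [|c2 [y [yE yP c2le]]] := @divn_carry P (y' + v + c1); first lia.
have -> : parabola_elt j' x' i' + (u + P * (v + P * k)) =
    parabola_elt (j' + k + c2) x (i + c1).
  rewrite /parabola_elt -/y'.
  have -> : (i + c1 + x ^ 2) %% P = y.
    (* Mod [P], [x] is [x' + u]; adding [x' ^ 2 + c1] to both sides of [E] gives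
       [i + c1 + (x' + u) ^ 2 = y' + v + c1]. *)
    have -> : i + c1 + x ^ 2 = i + c1 + (x' + u) ^ 2 %[mod P].
      by rewrite xE -(modnDmr _ ((x + _) ^ 2)) -modnXm (addnC x) (mulnC P) modnMDl modnXm modnDmr.
    rewrite -[RHS](modn_small yP) -(modnMDl c2 y P) (mulnC c2) (addnC _ y) -yE.
    rewrite -(addnA y') /y' modnDml.
    have -> : i' + x' ^ 2 + (v + c1) = (i' + v) + (x' ^ 2 + c1) by clear; lia.
    by rewrite -[RHS]modnDml -E modnDml; congr (_ %% _); clear; lia.
  clear E; clearbody y'; have {}yE := congr1 (muln P) yE; lia.
apply: mem_parabola => //.
move: c1le Hi; rewrite ltn_predRL leq_min => c1le /andP[Hi1 Hi2].
apply: (@leq_ltn_trans i.+1); first by rewrite -addn1 leq_add2l.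
by case: c2 c2le {yE} => [|[]] //; rewrite addn0.
Qed.

(* As 2u is invertible mod P, every pair of levels (i', i) is realized by exactly one x'. *)
Lemma parabola_rep (A : {fset int}) (d g : nat) :
  coprime P (2 * (d %% P)) ->
  (forall a, a \in parabola_seq -> Posz a \in A) ->
  g <= \sum_(j < H) n j *
    (minn (n (j + d %/ (P * P))) (n (j + d %/ (P * P) + 1))).-1 ->
  g <= diff_rep A d.
Proof.
move=> cop sA; set k := d %/ (P * P) => /leq_trans; apply.
pose u := d %% P; pose v := d %/ P %% P.
have dE : d = u + P * (v + P * k).
  rewrite /k divnMA addnC mulnC {1}(divn_eq d P); congr (_ * _ + _).
  by rewrite addnC mulnC -divn_eq.
have uP : u < P by rewrite ltn_mod.
have vP : v < P by rewrite ltn_mod.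
pose w j := (minn (n (j + k)) (n (j + k + 1))).-1.
have wP j : w j <= P.
  by rewrite /w; apply: leq_trans (leq_pred _) _; apply: leq_trans (geq_minl _ _) (n_le _).
have sol i' i : exists x, (x < P) && (2 * u * x + (u ^ 2 + i) == i' + v %[mod P]).
  have [x xP /eqP E] := modn_solve (u ^ 2 + i) (i' + v) P_gt0 cop.
  by exists x; rewrite xP.
pose X i' i := xchoose (sol i' i).
have XP i' i : X i' i < P by have /andP[] := xchooseP (sol i' i).
have XE i' i : 2 * u * X i' i + (u ^ 2 + i) = i' + v %[mod P].
  by have /andP[_ /eqP] := xchooseP (sol i' i).
(* [q < n j * w j] encodes the two levels [i' = q %/ w j < n j] and [i = q %% w j < w j]. *)
pose F j q := parabola_elt j (X (q %/ w j) (q %% w j)) (q %/ w j).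
pose s := [seq F j q | j <- iota 0 H, q <- iota 0 (n j * w j)].
have <- : size s = \sum_(j < H) n j * w j.
  rewrite size_allpairs_dep -(big_mkord xpredT (fun j => n j * w j)).
  rewrite /index_iota subn0 sumnE big_map.
  by apply: eq_bigr => j _; rewrite size_iota.
apply: leq_diff_rep.
  apply: allpairs_uniq_dep; [exact: iota_uniq|by move=> *; exact: iota_uniq|].
  (* The base [P] digits give back [x'], then [i'] (as [i' < P]) and [j]; the congruence solved by
     [x'] then gives back [i]. *)
  move=> _ _ /allpairsPdep[j [q [_ + ->]]] /allpairsPdep[j' [q' [_ + ->]]] /=.
  rewrite !mem_iota !add0n /= => qj qj'; rewrite /F.
  have w0 : 0 < w j by case: (w j) qj => //; rewrite muln0.
  move=> /(euclid_inj (XP _ _) (XP _ _))[EX].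
  have mP b : b %% P < P by rewrite ltn_mod.
  move=> /(euclid_inj (mP _) (mP _))[Ei Ej]; subst j'.
  have iP : q %/ w j < P by rewrite (leq_trans _ (n_le j)) // ltn_divLR.
  have iP' : q' %/ w j < P by rewrite (leq_trans _ (n_le j)) // ltn_divLR.
  move: Ei; rewrite EX => /eqP; rewrite eqn_modDr !modn_small // => /eqP Ei.
  have := XE (q %/ w j) (q %% w j); rewrite EX Ei -(XE _ (q' %% w j)) => /eqP.
  have wlt b : b %% w j < P by rewrite (leq_trans (ltn_pmod _ w0)).
  rewrite eqn_modDl eqn_modDl (modn_small (wlt q)) (modn_small (wlt q')) => /eqP Em.
  by rewrite (divn_eq q (w j)) (divn_eq q' (w j)) Ei Em.
move=> _ /allpairsPdep[j [q [_ + ->]]]; rewrite mem_iota add0n /= => qj.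
have w0 : 0 < w j by case: (w j) qj => //; rewrite muln0.
apply/andP; split; apply: sA.
  by apply: mem_parabola; rewrite // ltn_divLR.
rewrite dE; apply: parabola_shift (XE _ _) _ => //.
by rewrite -/(w j) ltn_pmod.
Qed.
End parabola.

(** After division by [r]: an initial segment of length [g * a] and multiples of [a]. Subtracting
    [d / r] from the [g] first multiples of [a] that are at least [d / r] lands in the segment. *)
Definition grid_seq (r g a N : nat) :=
  [seq r * y | y <- iota 0 (g * a)] ++
  [seq r * (a * i) | i <- iota 0 ((N %/ r) %/ a + g + 1)].

Lemma size_grid_seq r g a N :
  size (grid_seq r g a N) = g * a + ((N %/ r) %/ a + g + 1).
Proof. by rewrite size_cat !size_map !size_iota. Qed.

Lemma grid_rep (A : {fset int}) (r g a N d : nat) : 0 < r -> 0 < a ->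
  (forall b, b \in grid_seq r g a N -> Posz b \in A) ->
  r %| d -> d <= N -> g <= diff_rep A d.
Proof.
move=> r0 a0 sA /dvdnP[d' ->] dN; set i0 := (d' + a.-1) %/ a.
have i0l : d' <= a * i0.
  have := ltn_ceil (d' + a.-1) a0; rewrite -/i0; lia.
have i0u : a * i0 < d' + a.
  have := leq_trunc_div (d' + a.-1) a; rewrite -/i0; lia.
pose s := [seq r * (a * (i0 + l) - d') | l <- iota 0 g].
have <- : size s = g by rewrite size_map size_iota.
apply: leq_diff_rep.
  rewrite map_inj_in_uniq ?iota_uniq // => l l'; rewrite !mem_iota /= => _ _ /eqP.
  rewrite eqn_pmul2l // => /eqP E; apply/eqP.
  rewrite -(eqn_add2l i0) -(eqn_pmul2l a0); apply/eqP; nia.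
move=> _ /mapP[l + ->]; rewrite mem_iota add0n /= => lg.
apply/andP; split; apply: sA; rewrite mem_cat; apply/orP; [left|right]; apply/mapP.
  exists (a * (i0 + l) - d') => //; rewrite mem_iota add0n /=; nia.
exists (i0 + l); last by nia.
rewrite mem_iota add0n /=.
have : i0 <= N %/ r %/ a + 1.
  rewrite -ltnS -(@ltn_pmul2l a) //; move: (ltn_ceil (N %/ r) a0).
  have : d' <= N %/ r by rewrite leq_divRL.
  move: i0u; lia.
lia.
Qed.

(** If [r] does not divide [d], oddness of [r] makes [2 * (d %% r ^ e)] invertible and the parabola
    set represents [d]; otherwise the grid does. [K] bounds the quotient of [d] by
    [r ^ e * r ^ e]. *)
Lemma eta_parabola (r e H K g N a : nat) (n : nat -> nat) :
  prime r -> odd r -> 0 < e -> (forall j, n j <= r ^ e) -> (forall j, H <= j -> n j = 0) ->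
  0 < a -> N < r ^ e * r ^ e * K.+1 ->
  (forall k, k <= K ->
    g <= \sum_(j < H) n j * (minn (n (j + k)) (n (j + k + 1))).-1) ->
  eta g N <= r ^ e * \sum_(j < H) n j + (g * a + ((N %/ r) %/ a + g + 1)).
Proof.
move=> rP ro e0 nle ns a0 NK Hg.
rewrite -size_parabola_seq -(size_grid_seq r) -size_cat.
set s := _ ++ _; apply: leq_trans (card_fset_seq_le s).
rewrite /eta; case: ex_minnP => m _; apply; apply/asboolP; eexists; last reflexivity.
move=> d /andP[d0 dN]; case: (boolP (r %| d)) => rd.
  apply: (grid_rep (prime_gt0 rP) a0 _ rd dN) => b bs.
  by apply/imfsetP; exists b => //=; rewrite mem_cat bs orbT.
have cop : coprime (r ^ e) (2 * (d %% r ^ e)).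
  rewrite coprime_pexpl // prime_coprime // Euclid_dvdM // negb_or.
  apply/andP; split.
    apply/negP => /(dvdn_leq (isT : 0 < 2)).
    by move: ro (prime_gt1 rP); clear; case: r => [|[|[|]]].
  apply: contra rd => rd; rewrite (divn_eq d (r ^ e)) dvdn_addr //.
  by rewrite dvdn_mull // -(prednK e0) expnS dvdn_mulr.
have P0 : 0 < r ^ e by rewrite expn_gt0 prime_gt0.
apply: (parabola_rep P0 nle ns cop).
  by move=> b bs; apply/imfsetP; exists b => //=; rewrite mem_cat bs.
apply: Hg; rewrite -ltnS ltn_divLR ?muln_gt0 ?expn_gt0 ?prime_gt0 //.
by rewrite mulnC; apply: leq_ltn_trans NK.
Qed.

End parabola_sets.

(** * Reduction to Borel functions *)

Section measure.
Variable R : realType.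
Local Notation mu := (@lebesgue_measure R).
Local Notation cmu := (@completed_lebesgue_measure R).
Local Open Scope ereal_scope.

Lemma measurable_shift (x : R) :
  measurable_fun [set: measurableTypeR R] (fun t : R => (x + t)%R : measurableTypeR R).
Proof. by apply: measurable_funD; [exact: measurable_cst|exact: measurable_id]. Qed.

Lemma lebesgue_measure_shift (x : R) (A : set R) : measurable A ->
  mu ((fun t : R => (x + t)%R) @^-1` A) = mu A.
Proof.
move=> mA.
have mx := measurable_shift x.
pose m' := pushforward mu (fun t : R => (x + t)%R : measurableTypeR R).
rewrite [RHS](@lebesgue_measure_unique R m') //.
move=> _ [[a b] /= ab <-]; rewrite /m' /pushforward.
have -> : (fun t : R => (x + t)%R) @^-1` `]a, b] = `](a - x)%R, (b - x)%R]%classic.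
  by apply/seteqP; split => t /=; rewrite !in_itv /=; lra.
rewrite !lebesgue_measure_itv /= !lte_fin ltrD2r; case: ifP => // _.
by rewrite -!EFinD; congr EFin; ring.
Qed.

Lemma lebesgue_completed_measurable (A : set R) :
  measurable (A : set (measurableTypeR R)) -> measurable (A : set (lebesgueR R)).
Proof. exact: sub_caratheodory. Qed.

Lemma measurable_lebesgueR_id :
  measurable_fun [set: lebesgueR R] (fun x => x : measurableTypeR R).
Proof. by move=> _ Y mY; rewrite setTI; exact: lebesgue_completed_measurable. Qed.

(** The identity from [lebesgueR] to the Borel line pushes the completed measure forward to [mu]. *)
Lemma ge0_integral_completed (f : R -> \bar R) :
  measurable_fun [set: measurableTypeR R] f -> (forall x, 0 <= f x) ->
  \int[cmu]_x f x = \int[mu]_x f x.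
Proof.
move=> mf f0.
have := @ge0_integral_pushforward _ _ _ _ R
  (fun x : lebesgueR R => x : measurableTypeR R) measurable_lebesgueR_id cmu setT f
  measurableT mf (fun x _ => f0 x).
rewrite preimage_setT => <-.
by apply: eq_measure_integral; [exact: measurable_lebesgueR_id|].
Qed.

Lemma ge0_integral_shift (x : R) (f : R -> \bar R) :
  measurable_fun [set: R] f -> (forall t, 0 <= f t) ->
  \int[mu]_t f (x + t)%R = \int[mu]_t f t.
Proof.
move=> mf f0.
have := @ge0_integral_pushforward _ _ (measurableTypeR R) (measurableTypeR R) R _
  (measurable_shift x) mu setT f measurableT mf (fun x _ => f0 x).
rewrite preimage_setT => <-.
apply: eq_measure_integral; first exact: measurable_shift.
by move=> mx A mA _; exact: lebesgue_measure_shift.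
Qed.

(* The Borel structure is needed for Tonelli: for f merely Lebesgue measurable,
   (t, x) |-> f (t + x) need not be measurable for the product of the completed
   sigma-algebras. *)
Definition acorr (f : R -> R) (x : R) := \int[mu]_t (f t * f (x + t)%R)%:E.

(** The Caratheodory sigma-algebra is the completion of the Borel one. *)
Lemma completed_measurable_split (A : set R) : measurable (A : set (lebesgueR R)) ->
  exists B Z : set R, [/\ measurable B, measurable Z, mu Z = 0 & B `<=` A /\ A `<=` B `|` Z].
Proof.
move=> mA; have : completed_algebra_gen mu A.
  by rewrite -g_sigma_completed_algebra_genE completed_caratheodory_measurable.
case=> B mB [N [Z [mZ Z0 NZ]] <-]; exists B, Z; split => //; split; first exact: subsetUl.
by apply: setUS.
Qed.

(* f is set to 0 on a Borel null set Z that contains the non-Borel part of every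
   {f > q} with q rational. *)
Lemma lebesgue_Borel (f : R -> R) :
  measurable_fun [set: lebesgueR R] (f : lebesgueR R -> R) -> (forall x, (0 <= f x)%R) ->
  exists (Z : set R) (f0 : R -> R), [/\ measurable Z, mu Z = 0,
    measurable_fun [set: R] f0, (forall x, (0 <= f0 x <= f x)%R) &
    forall x, ~ Z x -> f0 x = f x].
Proof.
move=> mf f0.
(* [q] enumerates the rationals; codes of no rational give 0. *)
pose q (n : nat) : R := ratr (odflt 0%R (choice.unpickle n)).
have H n : exists BZ : set R * set R, [/\ measurable BZ.1, measurable BZ.2, mu BZ.2 = 0 &
   BZ.1 `<=` f @^-1` `]q n, +oo[ /\ f @^-1` `]q n, +oo[ `<=` BZ.1 `|` BZ.2].
  have := mf measurableT `]q n, +oo[%classic (measurable_itv _).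
  by rewrite setTI => /completed_measurable_split[B [Z ?]]; exists (B, Z).
have [BZ HBZ] := choice H.
pose Z := \bigcup_n (BZ n).2.
have mZ : measurable Z by apply: bigcupT_measurable => n; have [] := HBZ n.
exists Z, (fun x => f x * \1_(~` Z) x)%R; split => //.
- apply/negligibleP => //; apply: negligible_bigcup => n.
  by have [_ ? ? _] := HBZ n; apply/negligibleP.
- apply: (measurability _ (RGenOInfty.measurableE R)) => _ [_ [a ->] <-].
  rewrite setTI; have [a0|a0] := ltP a 0%R.
    rewrite (_ : _ @^-1` _ = setT) //; apply/seteqP; split => // x _ /=.
    by rewrite in_itv /= andbT (lt_le_trans a0) // mulr_ge0.
  (* Off [Z], [f x > a] iff [f x > q n] for some rational [q n >= a], and off [Z] the latter is
     membership in the Borel set [(BZ n).1]. *)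
  rewrite (_ : _ @^-1` _ = \bigcup_(n in [set n | (a <= q n)%R]) ((BZ n).1 `\` Z)).
    by apply: bigcup_measurable => n _; apply: measurableD => //; have [] := HBZ n.
  apply/seteqP; split => [x|x [n /= an [Bx Zx]]] /=; rewrite in_itv /= andbT indicE.
    have [Zx|Zx] := pselect (Z x); first by rewrite memNset //= mulr0 => /(le_lt_trans a0); rewrite ltxx.
    rewrite mem_set // mulr1 => /rat_in_itvoo[p]; rewrite in_itv /= => /andP[ap pf].
    have qE : q (choice.pickle p) = ratr p by rewrite /q choice.pickleK.
    exists (choice.pickle p); first by rewrite /= qE ltW.
    split => //; have [_ _ _ [_ /(_ x)]] := HBZ (choice.pickle p).
    rewrite /= in_itv /= andbT qE => /(_ pf)[//|Zp]; exfalso; apply: Zx.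
    by exists (choice.pickle p).
  rewrite mem_set // mulr1 (le_lt_trans an) //.
  by have [_ _ _ [/(_ x Bx) + _]] := HBZ n; rewrite /= in_itv /= andbT.
- move=> x; rewrite indicE; case: (_ \in _) => /=; rewrite ?mulr1 ?mulr0 ?lexx ?f0 //.
- by move=> x Zx; rewrite indicE mem_set // mulr1.
Qed.

Lemma autocorrE (f : R -> R) (x : R) : measurable_fun [set: R] f ->
  (forall x, (0 <= f x)%R) -> autocorr f x = acorr f x.
Proof.
move=> mf f0; apply: ge0_integral_completed => [|t]; last by rewrite lee_fin mulr_ge0.
apply/measurable_EFinP/measurable_funM => //.
by apply: measurableT_comp => //; exact: measurable_shift.
Qed.

(** Passing to the Borel minorant of [lebesgue_Borel] cannot raise the integral, and for fixed [x]
    it alters the integrand of the autocorrelation only on the null set [Z] and a translate of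
    it. *)
Lemma autocorr_class_Borel (f : R -> R) : autocorr_class f ->
  exists f0 : R -> R, [/\ measurable_fun [set: R] f0, (forall x, (0 <= f0 x)%R),
    (forall x, (0 <= x <= 1)%R -> 1 <= acorr f0 x) &
    \int[mu]_x (f0 x)%:E <= \int[cmu]_x (f x)%:E].
Proof.
move=> [mf f0 f1]; have [Z [h [mZ Z0 mh h0 hf]]] := lebesgue_Borel mf f0.
have h_ge0 x : (0 <= h x)%R by case/andP: (h0 x).
have mh' : measurable_fun [set: lebesgueR R] (h : lebesgueR R -> R).
  by apply: (measurableT_comp (T2 := measurableTypeR R)) measurable_lebesgueR_id.
exists h; split => //.
- move=> x x01; rewrite -autocorrE //; apply: le_trans (f1 x _) _; first by rewrite in_itv.
  rewrite /autocorr.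
  have mhx : measurable_fun [set: lebesgueR R] (fun t : lebesgueR R => (h t * h (x + t)%R)%:E).
    apply/measurable_EFinP/measurable_funM => //.
    have mhs : measurable_fun [set: measurableTypeR R] (fun t : R => h (x + t)%R).
      by apply: measurableT_comp => //; exact: measurable_shift.
    exact: (measurableT_comp mhs measurable_lebesgueR_id).
  have ae : ae_eq cmu setT (fun t => (h t * h (x + t)%R)%:E) (fun t => (f t * f (x + t)%R)%:E).
    exists (Z `|` (fun t => x + t)%R @^-1` Z); split => /=.
    + apply: lebesgue_completed_measurable; apply: measurableU => //.
      by rewrite -[_ @^-1` _]setTI; exact: measurable_shift.
    + have mZx : measurable ((fun t => x + t)%R @^-1` Z : set (measurableTypeR R)).
        by rewrite -[_ @^-1` _]setTI; exact: measurable_shift.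
      have <- : mu (Z `|` (fun t => x + t)%R @^-1` Z) = 0.
        by rewrite measureU0 //; exact: etrans (lebesgue_measure_shift x mZ) Z0.
      by [].
    + move=> t /= Ht; apply: contrapT => /not_orP[Zt Zxt]; apply: Ht => _.
      by rewrite !hf.
  (* Completeness of the measure makes the product measurable although [f] need not be Borel. *)
  have mfx := ae_measurable_fun (@completed_lebesgue_measure_is_complete R) ae mhx.
  have f_ge0 t : setT t -> 0 <= (f t * f (x + t)%R)%:E by rewrite lee_fin mulr_ge0.
  have h_ge0' t : setT t -> 0 <= (h t * h (x + t)%R)%:E by rewrite lee_fin mulr_ge0.
  by rewrite (ge0_ae_eq_integral measurableT mhx mfx h_ge0' f_ge0 ae).
- rewrite -ge0_integral_completed => [||x]; rewrite ?lee_fin //; last exact/measurable_EFinP.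
  apply: ge0_le_integral; [exact: measurableT| | | |].
  + by move=> x _; rewrite lee_fin.
  + exact/measurable_EFinP.
  + exact/measurable_EFinP.
  + by move=> x _; rewrite lee_fin; case/andP: (h0 x).
Qed.
End measure.

(** * Discretization of a function with large autocorrelation *)

(** A window containing the cell [i] has [p] among [i + J + 1, ..., i + J + s]. *)
Lemma window_count (J s n : nat) (i : int) :
  (\sum_(p < n) (p%:Z - J%:Z - s%:Z <= i < p%:Z - J%:Z)%R <= s)%N.
Proof.
rewrite -big_mkcond /= sum1_card -[leqRHS](size_iota 0 s).
rewrite -[leqRHS](size_map (fun l : nat => (i + J%:Z + 1 + l%:Z)%R)) cardE.
rewrite -[leqLHS](size_map (fun p : 'I_n => (p : nat)%:Z)).
apply: uniq_leq_size.
  by rewrite map_inj_uniq ?enum_uniq // => p q [] /val_inj.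
move=> _ /mapP[p + ->]; rewrite mem_enum unfold_in => Hp.
by apply/mapP; exists (absz (p%:Z - (i + J%:Z + 1))%R); rewrite ?mem_iota; lia.
Qed.

(* With e := i' - i - c in {0, 1}, the pair (a, b) is mapped to the window
   p = i + J + s - b + e. *)
Lemma window_pair_count (J s k : nat) (i i' c : int) :
  (- J%:Z <= i < J%:Z)%R -> (c <= i' - i <= c + 1)%R ->
  (\sum_(a < s) \sum_(b < s) (c == k%:Z + a%:Z - b%:Z)%R <=
   \sum_(p < (2 * J + s).+1) ((p%:Z - J%:Z - s.+1%:Z <= i < p%:Z - J%:Z)%R *
     ((p + k)%:Z - J%:Z - s.+1%:Z + 1 <= i' < (p + k)%:Z - J%:Z)%R))%N.
Proof.
move=> Hi Hc; rewrite pair_big /=.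
rewrite (eq_bigr (fun p : 'I_s * 'I_s => if (c == k%:Z + p.1%:Z - p.2%:Z)%R then 1 else 0)%N);
  last by move=> p _; case: eqP.
rewrite -big_mkcond /= sum1_card.
under [leqRHS]eq_bigr do rewrite mulnb.
rewrite (eq_bigr (fun p : 'I_(2 * J + s).+1 => if [&& (p%:Z - J%:Z - s.+1%:Z <= i < p%:Z - J%:Z) &
     ((p + k)%:Z - J%:Z - s.+1%:Z + 1 <= i' < (p + k)%:Z - J%:Z)]%R then 1 else 0)%N);
  last by move=> p _; case: ifP.
rewrite -big_mkcond /= sum1_card.
pose h (p : 'I_s * 'I_s) : 'I_(2 * J + s).+1 :=
  inord (absz (i + J%:Z + s.+1%:Z - 1 - p.2%:Z + (i' - i - c))%R).
set X := (X in (#|X| <= _)%N); set Y := (X in (_ <= #|X|)%N).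
have hE p : (h p)%:Z = (i + J%:Z + s.+1%:Z - 1 - p.2%:Z + (i' - i - c))%R.
  have := ltn_ord p.2; rewrite /h => p2; rewrite inordK; lia.
rewrite -(@card_in_image _ _ h X).
  apply/subset_leq_card/fintype.subsetP => _ /fintype.imageP[p pX ->].
  have /eqP cE : (c == k%:Z + p.1%:Z - p.2%:Z)%R := pX.
  rewrite unfold_in /Y; have := hE p; move: (nat_of_ord (h p)) => q.
  have := ltn_ord p.1; have := ltn_ord p.2; move: cE Hi Hc.
  move: (nat_of_ord p.1) (nat_of_ord p.2) => a b; clear => cE Hi Hc bs as_ hq.
  rewrite PoszD hq; subst c; clear hq; lia.
move=> [a b] [a' b'] pX pX'.
have /eqP E : (c == k%:Z + a%:Z - b%:Z)%R := pX.
have /eqP E' : (c == k%:Z + a'%:Z - b'%:Z)%R := pX'.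
move=> /(congr1 (fun p : 'I__ => (p : nat)%:Z)); rewrite !hE /= => Eb.
by congr pair; apply/val_inj => /=; lia.
Qed.

Lemma measurable_indicT (R : realType) (S : set R) :
  measurable S -> measurable_fun [set: R] (\1_S : R -> R).
Proof. by move=> mS; apply: measurable_indic. Qed.

Section discretization.
Variable R : realType.
Local Notation mu := (@lebesgue_measure R).
Variables (f : R -> R) (m : nat).
Hypothesis mf : measurable_fun [set: R] f.
Hypothesis f0 : forall x, 0 <= f x.
Hypothesis m0 : (0 < m)%N.

(* The union of the cells p, ..., q - 1 of the grid of mesh 1 / m. *)
Definition window (p q : int) : set R := `[p%:~R / m%:R, q%:~R / m%:R[%classic.

Let mR : 0 < m%:R :> R. Proof. by rewrite ltr0n. Qed.

Lemma window_floor p q t : window p q t <-> p <= Num.floor (m%:R * t) < q.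
Proof.
rewrite /window /= in_itv /= floor_ge_int floor_lt_int.
by rewrite ler_pdivrMr // ltr_pdivlMr // mulrC.
Qed.

Lemma indic_window p q t : \1_(window p q) t = ((p <= Num.floor (m%:R * t) < q)%R)%:R :> R.
Proof.
rewrite indicE; congr (_%:R); congr nat_of_bool.
by apply/idP/idP; rewrite inE => /window_floor.
Qed.

Lemma measurable_window p q : measurable (window p q).
Proof. exact: measurable_itv. Qed.

Lemma measurable_indic_window p q : measurable_fun [set: R] (\1_(window p q) : R -> R).
Proof. by apply: measurable_indicT; exact: measurable_window. Qed.

Local Open Scope ereal_scope.

Lemma mu_window (p : int) : mu (window p (p + 1)%R) = (m%:R^-1)%:E.
Proof.
rewrite /window lebesgue_measure_itv /= lte_fin ltr_pM2r ?invr_gt0 // ltr_int.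
rewrite ltrDl ltr01 -EFinD -mulrBl intrD; congr EFin.
by rewrite addrC addKr mul1r.
Qed.

Lemma acorrN (x : R) : acorr f (- x) = acorr f x.
Proof.
rewrite /acorr -(ge0_integral_shift x) => [||t]; rewrite ?lee_fin ?mulr_ge0 //.
  by under eq_integral do rewrite addKr mulrC.
apply/measurable_EFinP/measurable_funM => //.
by apply: measurableT_comp => //; exact: measurable_shift.
Qed.

(** Its double integral is the integral of [acorr f] over the cell [c]. *)
Definition pair_weight (c : int) (z : R * R) : \bar R :=
  (f z.1 * f z.2 * \1_(window c (c + 1)%R) (z.2 - z.1))%:E.

Lemma measurable_pair_weight c : measurable_fun [set: R * R] (pair_weight c).
Proof.
apply/measurable_EFinP/measurable_funM.
  apply: measurable_funM.
    by apply: (measurableT_comp mf); exact: measurable_fst.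
  by apply: (measurableT_comp mf); exact: measurable_snd.
apply: measurableT_comp; first exact: measurable_indic_window.
by apply: measurable_funB; [exact: measurable_snd|exact: measurable_fst].
Qed.

Lemma pair_weight_ge0 c z : 0 <= pair_weight c z.
Proof. by rewrite lee_fin !mulr_ge0. Qed.

Definition cell_weight (c : int) (t : R) : \bar R := \int[mu]_s pair_weight c (t, s).

Lemma cell_weight_ge0 c t : 0 <= cell_weight c t.
Proof. by apply: integral_ge0 => s _; exact: pair_weight_ge0. Qed.

Lemma measurable_cell_weight c : measurable_fun [set: R] (cell_weight c).
Proof.
exact: (measurable_fun_fubini_tonelli_F (m2 := mu) (pair_weight c)
  (measurable_pair_weight c) (pair_weight_ge0 c)).
Qed.

Hypothesis f1 : forall x : R, (0 <= x <= 1)%R -> 1 <= acorr f x.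

Lemma acorr_ge1 (x : R) : (-1 <= x <= 1)%R -> 1 <= acorr f x.
Proof.
move=> x1; have [x0|x0] := leP 0%R x; first by apply: f1; lra.
by rewrite -acorrN; apply: f1; lra.
Qed.

(** The shear [s = t + x] and Tonelli turn the left-out double integral into that of [acorr f] over
    a cell of length [1 / m]; the range of [c] keeps this cell inside [-1, 1], where
    [acorr f >= 1]. *)
Lemma integral_cell_weight c : (- m%:Z <= c < m%:Z)%R ->
  (m%:R^-1)%:E <= \int[mu]_t cell_weight c t.
Proof.
move=> cm.
pose F (z : R * R) : \bar R :=
  (f z.1 * f (z.1 + z.2) * \1_(window c (c + 1)%R) z.2)%:E.
have mF : measurable_fun [set: R * R] F.
  apply/measurable_EFinP/measurable_funM.
    apply: measurable_funM.
      by apply: (measurableT_comp mf); exact: measurable_fst.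
    apply: (measurableT_comp mf).
    by apply: measurable_funD; [exact: measurable_fst|exact: measurable_snd].
  apply: measurableT_comp; first exact: measurable_indic_window.
  exact: measurable_snd.
have F0 z : 0 <= F z by rewrite lee_fin !mulr_ge0.
have E t : cell_weight c t = \int[mu]_x F (t, x).
  rewrite /cell_weight -(ge0_integral_shift t) => [||s]; last exact: pair_weight_ge0.
    apply: eq_integral => x _; rewrite /pair_weight /F /=.
    by rewrite addrAC subrr add0r.
  by apply: measurableT_comp; [exact: measurable_pair_weight|exact: measurable_pair1].
under eq_integral do rewrite E.
rewrite (fubini_tonelli (m1 := mu) (m2 := mu) F mF F0).
rewrite -(mu_window c) -[window _ _]setIT -integral_indic //; last exact: measurable_window.
apply: ge0_le_integral; [exact: measurableT| | | |].
- by move=> x _; rewrite lee_fin.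
- by apply/measurable_EFinP; exact: measurable_indic_window.
- exact: (measurable_fun_fubini_tonelli_G (m1 := mu) F mF F0).
- move=> x _; rewrite /F indicE; case: (boolP (x \in _)) => [|_]; last first.
    by apply: integral_ge0 => t _; rewrite mulr0.
  rewrite inE => /window_floor xc.
  under eq_integral do rewrite /= mulr1 addrC.
  apply: acorr_ge1.
  have : (- m%:Z <= Num.floor (m%:R * x) < m%:Z)%R by lia.
  rewrite floor_ge_int floor_lt_int mulrNz -[m%:~R]mulr1 -mulrN ler_pM2l // ltr_pM2l //.
  by case/andP => -> /ltW ->.
Qed.

Variable I : R.
Hypothesis fI : \int[mu]_x (f x)%:E = I%:E.

Definition mass (p q : int) : R := fine (\int[mu]_t (f t * \1_(window p q) t)%:E).

Lemma measurable_fwindow p q : measurable_fun [set: R] (fun t => (f t * \1_(window p q) t)%:E).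
Proof. by apply/measurable_EFinP/measurable_funM => //; exact: measurable_indic_window. Qed.

Lemma fwindow_ge0 p q t : 0 <= (f t * \1_(window p q) t)%:E.
Proof. by rewrite lee_fin mulr_ge0. Qed.

Lemma integral_fwindow_le p q : \int[mu]_t (f t * \1_(window p q) t)%:E <= I%:E.
Proof.
rewrite -fI; apply: ge0_le_integral; [exact: measurableT| | | |].
- by move=> t _; exact: fwindow_ge0.
- exact: measurable_fwindow.
- exact/measurable_EFinP.
- by move=> t _; rewrite lee_fin ler_piMr // indicE; case: (_ \in _).
Qed.

Lemma massE p q : (mass p q)%:E = \int[mu]_t (f t * \1_(window p q) t)%:E.
Proof.
rewrite fineK // ge0_fin_numE; first exact: le_lt_trans (integral_fwindow_le p q) (ltry _).
by apply: integral_ge0 => t _; exact: fwindow_ge0.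
Qed.

Lemma mass_ge0 p q : (0 <= mass p q)%R.
Proof. by rewrite -lee_fin massE; apply: integral_ge0 => t _; exact: fwindow_ge0. Qed.

Lemma mass_le p q : (mass p q <= I)%R.
Proof. by rewrite -lee_fin massE integral_fwindow_le. Qed.

Lemma mass_mono p q p' q' : (p' <= p)%R -> (q <= q')%R -> (mass p q <= mass p' q')%R.
Proof.
move=> pp qq; rewrite -lee_fin !massE; apply: ge0_le_integral; [exact: measurableT| | | |].
- by move=> t _; exact: fwindow_ge0.
- exact: measurable_fwindow.
- exact: measurable_fwindow.
- move=> t _; rewrite lee_fin ler_wpM2l // !indic_window ler_nat.
  by case: (boolP (p <= _ < q)%R) => //= ?; rewrite lt0b; lia.
Qed.

(** By [window_count] each point lies in at most [s] of these windows; integrate against [f]. *)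
Lemma sum_mass_le (J s n : nat) :
  (\sum_(p < n) mass (p%:Z - J%:Z - s%:Z) (p%:Z - J%:Z) <= s%:R * I)%R.
Proof.
rewrite -lee_fin -sumEFin EFinM -fI -ge0_integralZl_EFin //; last 2 first.
- by move=> t _; rewrite lee_fin.
- exact/measurable_EFinP.
under eq_bigr do rewrite massE.
rewrite -ge0_integral_sum; [|exact: measurableT| |].
- apply: ge0_le_integral; [exact: measurableT| | | |].
  + by move=> t _; apply: sume_ge0 => p _; exact: fwindow_ge0.
  + by apply: emeasurable_sum => p; exact: measurable_fwindow.
  + by apply: measurable_funeM; exact/measurable_EFinP.
  + move=> t _; rewrite sumEFin -EFinM lee_fin -mulr_sumr mulrC ler_wpM2r //.
    under eq_bigr do rewrite indic_window.
    by rewrite -natr_sum ler_nat window_count.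
- by move=> p; exact: measurable_fwindow.
- by move=> p t _; exact: fwindow_ge0.
Qed.

(** Both sides are double integrals of multiples of [f t * f u]; the coefficients are compared
    pointwise by [window_pair_count], applied to the cells of [t], [u] and [u - t]. Cutting [t] to a
    bounded window makes finitely many [p] suffice. *)
Lemma sum_cell_weight_le (J s k : nat) :
  \sum_(ab : 'I_s * 'I_s)
    \int[mu]_(t in window (- J%:Z) J%:Z) cell_weight (k%:Z + ab.1%:Z - ab.2%:Z) t <=
  (\sum_(p < (2 * J + s).+1) mass (p%:Z - J%:Z - s.+1%:Z) (p%:Z - J%:Z) *
     mass ((p + k)%:Z - J%:Z - s.+1%:Z + 1) ((p + k)%:Z - J%:Z))%:E.
Proof.
set T := window _ _; have mT : measurable T := measurable_window _ _.
pose W p := (\1_(window (p%:Z - J%:Z - s.+1%:Z) (p%:Z - J%:Z)) : R -> R).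
pose W' p := (\1_(window (p%:Z - J%:Z - s.+1%:Z + 1) (p%:Z - J%:Z)) : R -> R).
pose D p := mass (p%:Z - J%:Z - s.+1%:Z + 1) (p%:Z - J%:Z).
pose A p t : \bar R := (f t * W p t)%:E * (D (p + k)%N)%:E.
have A0 p t : 0 <= A p t by rewrite mule_ge0 ?fwindow_ge0 // lee_fin mass_ge0.
have mA p : measurable_fun [set: R] (A p).
  by apply: emeasurable_funM => //; exact: measurable_fwindow.
apply: (@le_trans _ _ (\sum_(p < (2 * J + s).+1) \int[mu]_(t in T) A p t)); last first.
  rewrite -sumEFin; apply: lee_sum => p _.
  rewrite EFinM massE -ge0_integralZr ?lee_fin ?mass_ge0 //; last 2 first.
  - exact: measurable_fwindow.
  - by move=> t _; exact: fwindow_ge0.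
  apply: ge0_subset_integral => //; exact: mA.
rewrite -ge0_integral_sum; [|exact: mT
  |by move=> ab; apply: measurable_funTS; exact: measurable_cell_weight
  |by move=> ab t _; exact: cell_weight_ge0].
rewrite -ge0_integral_sum; [|exact: mT
  |by move=> p; apply: measurable_funTS; exact: mA|by move=> p t _; exact: A0].
apply: ge0_le_integral => //.
- by move=> t _; apply: sume_ge0 => ab _; exact: cell_weight_ge0.
- by apply: measurable_funTS; apply: emeasurable_sum => ab; exact: measurable_cell_weight.
- by apply: measurable_funTS; apply: emeasurable_sum => p; exact: mA.
move=> t tT.
have AE p : A p t = \int[mu]_s ((f t * W p t)%:E * (f s * W' (p + k)%N s)%:E).
  rewrite /A massE ge0_integralZl_EFin // ?mulr_ge0 // => [u _|].
    exact: fwindow_ge0.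
  exact: measurable_fwindow.
under [leRHS]eq_bigr do rewrite AE.
have mc c : measurable_fun [set: R] (fun s => pair_weight c (t, s)).
  by apply: measurableT_comp; [exact: measurable_pair_weight|exact: measurable_pair1].
have mW p : measurable_fun [set: R] (fun s => (f t * W p t)%:E * (f s * W' (p + k)%N s)%:E).
  by apply: emeasurable_funM => //; exact: measurable_fwindow.
have W0 p u : 0 <= (f t * W p t)%:E * (f u * W' (p + k)%N u)%:E.
  by rewrite mule_ge0 // lee_fin mulr_ge0.
rewrite -ge0_integral_sum; [|exact: measurableT|by move=> ab; exact: mc
  |by move=> ab u _; exact: pair_weight_ge0].
rewrite -ge0_integral_sum; [|exact: measurableT|by move=> p; exact: mW
  |by move=> p u _; exact: W0].
apply: ge0_le_integral => //.
- by move=> u _; apply: sume_ge0 => ab _; exact: pair_weight_ge0.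
- by apply: emeasurable_sum => ab; exact: mc.
- by apply: emeasurable_sum => p; exact: mW.
move=> u _; rewrite /pair_weight sumEFin /=.
under [leRHS]eq_bigr do rewrite -EFinM mulrACA.
rewrite sumEFin lee_fin -!mulr_sumr ler_wpM2l ?mulr_ge0 //.
under eq_bigr do rewrite indic_window.
under [leRHS]eq_bigr do rewrite /W /W' !indic_window -natrM.
rewrite -!natr_sum ler_nat.
set i := Num.floor (m%:R * t); set i' := Num.floor (m%:R * u).
set c := Num.floor _.
have := @window_pair_count J s k i i' c.
rewrite pair_big /= => H; apply: leq_trans (H _ _).
- by apply: leq_sum => ab _; lia.
- by apply/window_floor.
(* [i' - i] differs from [m * (u - t)] by less than 1, so it is [c] or [c + 1]. *)
- have := floor_itv (m%:R * t); have := floor_itv (m%:R * u).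
  have := floor_itv (m%:R * (u - t)); rewrite -/i -/i' -/c mulrBr.
  move=> /andP[c1 c2] /andP[i'1 i'2] /andP[i1 i2].
  apply/andP; split; rewrite -ltzD1 -(ltr_int R); move: c2 i'2 i2; rewrite !intrD ?intrB; lra.
Qed.

(** Monotone convergence along windows exhausting the line; the strict bound on [y] is what lets a
    finite [J] suffice. *)
Lemma near_cell_weight c (y : R) : (- m%:Z <= c < m%:Z)%R -> (y < m%:R^-1)%R ->
  \forall J \near \oo, y%:E <= \int[mu]_(t in window (- J%:Z) J%:Z) cell_weight c t.
Proof.
move=> cm ym.
have hF : {homo (fun J : nat => window (- J%:Z) J%:Z) : n k / (n <= k)%N >-> (n <= k)%O}.
  by move=> n k nk; apply/subsetPset => t /window_floor ?; apply/window_floor; lia.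
have UF : \bigcup_J window (- J%:Z) J%:Z = [set: R].
  apply/seteqP; split => // t _; exists (absz (Num.floor (m%:R * t))).+1 => //.
  by apply/window_floor; lia.
have mF (J : nat) : measurable (window (- J%:Z) J%:Z) by exact: measurable_window.
have mw (J : nat) : measurable_fun (window (- J%:Z) J%:Z) (cell_weight c).
  by apply: measurable_funTS; exact: measurable_cell_weight.
have := ge0_nondecreasing_set_cvg_integral (T := measurableTypeR R) (mu := mu)
  hF mF mw (fun J t _ => cell_weight_ge0 c t).
rewrite UF => cv; have : nbhs (\int[mu]_t cell_weight c t) (fun u => y%:E < u).
  by apply: open_ereal_gt'; apply: lt_le_trans (integral_cell_weight cm); rewrite lte_fin.
move=> /cv H.
have {}H : \forall J \near \oo, y%:E < \int[mu]_(t in window (- J%:Z) J%:Z) cell_weight c t by exact: H.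
by near=> J; apply: ltW; near: J; exact: H.
Unshelve. all: by end_near.
Qed.

(* C p is the integral of f over s + 1 consecutive cells, and D p the one over the
   cells common to the windows p and p + 1. *)
Lemma discretization (s : nat) (d : R) : (s <= m)%N -> (0 < d)%R ->
  exists (H : nat) (C D : nat -> R),
  [/\ forall p, [/\ 0 <= D p, D p <= C p, D p <= C p.+1 & C p <= I]%R,
      forall n, (\sum_(p < n) C p <= s.+1%:R * I)%R &
      forall k, (k + s <= m)%N ->
        ((1 - d) * s%:R ^+ 2 / m%:R <= \sum_(p < H) C p * D (p + k)%N)%R].
Proof.
(* The loss [d] leaves room for one finite [J] to serve all [2 * m] cells. *)
move=> sm d0; pose y : R := ((1 - d) / m%:R)%R.
have ym : (y < m%:R^-1)%R.
  by rewrite /y ltr_pdivrMr // mulVf ?gt_eqF // ltrBlDr ltrDl.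
have : \forall J \near \oo, forall l : 'I_(2 * m),
    y%:E <= \int[mu]_(t in window (- J%:Z) J%:Z) cell_weight (l%:Z - m%:Z)%R t.
  apply: filter_forall => l; apply: near_cell_weight => //.
  by have := ltn_ord l; lia.
move=> /filter_ex[J HJ].
exists (2 * J + s).+1, (fun p => mass (p%:Z - J%:Z - s.+1%:Z) (p%:Z - J%:Z)),
  (fun p => mass (p%:Z - J%:Z - s.+1%:Z + 1) (p%:Z - J%:Z)); split.
- move=> p; split; [exact: mass_ge0| | |exact: mass_le].
    by apply: mass_mono; lia.
  by apply: mass_mono; lia.
- by move=> n; exact: sum_mass_le.
- move=> k ks; rewrite -lee_fin; apply: le_trans (sum_cell_weight_le J s k).
  apply: (@le_trans _ _ (\sum_(ab : 'I_s * 'I_s) y%:E)).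
    rewrite sumEFin lee_fin sumr_const card_prod card_ord -[X in (_ <= X)%R]mulr_natl.
    by rewrite /y natrM expr2 mulrAC mulrC mulrA.
  apply: lee_sum => -[a b] _ /=.
  (* [k + s <= m] keeps every [k + a - b] in the range [-m, m) of [HJ]. *)
  have ltl : (absz (k%:Z + a%:Z - b%:Z + m%:Z)%R < 2 * m)%N.
    by have := ltn_ord a; have := ltn_ord b; lia.
  have -> : (k%:Z + a%:Z - b%:Z = (Ordinal ltl : nat)%:Z - m%:Z)%R.
    by rewrite /=; have := ltn_ord a; have := ltn_ord b; lia.
  exact: HJ.
Qed.
End discretization.

(** * Step functions from difference sets *)

Lemma diff_rep_le (A : {fset int}) (d : int) :
  (diff_rep A d <= size [seq a <- enum_fset A | (a + d)%R \in A])%N.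
Proof.
pose B := [fset a in A | (a + d)%R \in A]%fset.
apply: (@leq_trans #|` [fset (a + d, a)%R | a in B]|%fset).
  apply/fsubset_leq_card/fsubsetP => -[p q]; rewrite !inE /= => /andP[/andP[pA qA] /eqP E].
  have pE : p = (q + d)%R by lia.
  by apply/imfsetP; exists q; rewrite ?pE //= !inE /= qA -pE.
apply: leq_trans (leq_imfset_card _ _ _) _.
rewrite -(size_map id) uniq_leq_size // ?map_id ?fset_uniq // => a.
by rewrite mem_filter !inE /= andbC.
Qed.

Lemma sum_eq_mem (R : pzSemiRingType) (s : seq int) (i : int) (b : bool) : uniq s ->
  \sum_(a <- s) ((i == a) && b)%:R = ((i \in s) && b)%:R :> R.
Proof.
elim: s => [|a s IH] /=; first by rewrite big_nil.
move=> /andP[as_ us]; rewrite big_cons IH // in_cons.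
by case: eqP => [->|_]; rewrite ?add0r //= (negbTE as_) /= addr0.
Qed.

Section lower.
Variable R : realType.
Local Notation mu := (@lebesgue_measure R).
Variables (A : {fset int}) (g N : nat).
Hypotheses (g0 : (0 < g)%N) (N0 : (0 < N)%N) (AgN : diff_set g N A).

Let NR : 0 < N%:R :> R. Proof. by rewrite ltr0n. Qed.
(** Chosen so that [c ^+ 2 / N = 1 / g]: two coinciding cells contribute [1 / g] to the
    autocorrelation. *)
Let c : R := Num.sqrt (N%:R / g%:R).

Definition step (t : R) : R := c * \sum_(a <- enum_fset A) \1_(window N a (a + 1)) t.

Lemma stepE t : step t = c * (Num.floor (N%:R * t) \in A)%:R.
Proof.
rewrite /step; congr (_ * _); rewrite -[_ \in A]andbT -sum_eq_mem ?fset_uniq //.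
by apply: eq_bigr => a _; rewrite indic_window //; congr (_%:R); congr nat_of_bool; lia.
Qed.

Lemma measurable_step : measurable_fun [set: R] step.
Proof.
apply: measurable_funM => //; apply: measurable_sum => a.
exact: measurable_indic_window.
Qed.

Lemma step_ge0 t : 0 <= step t.
Proof. by rewrite stepE mulr_ge0 // sqrtr_ge0. Qed.

Local Open Scope ereal_scope.

Lemma integral_step :
  \int[mu]_t (step t)%:E = (#|` A|%:R / Num.sqrt (g * N)%:R)%:E.
Proof.
under eq_integral do rewrite EFinM -sumEFin.
rewrite ge0_integralZl_EFin //; last 3 first.
- by move=> t _; apply: sume_ge0 => a _; rewrite lee_fin.
- apply: emeasurable_sum => a; apply/measurable_EFinP; exact: measurable_indic_window.
- exact: sqrtr_ge0.
rewrite ge0_integral_sum; [|exact: measurableT| |]; last 2 first.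
- by move=> a; apply/measurable_EFinP; exact: measurable_indic_window.
- by move=> a t _; rewrite lee_fin.
have E a : \int[mu]_t (\1_(window N a (a + 1)%R) t)%:E = (N%:R^-1)%:E.
  rewrite integral_indic //; last exact: measurable_window.
  by rewrite setIT; exact: mu_window.
under eq_bigr do rewrite E.
rewrite sumEFin -EFinM big_const_seq count_predT iter_addr_0; congr EFin.
have gR : (0 < g%:R :> R)%R by rewrite ltr0n.
rewrite -[(_^-1 *+ _)%R]mulr_natr mulrA mulrC; congr (_ * _)%R.
apply: (@mulIf _ (Num.sqrt (g * N)%:R)); first by rewrite gt_eqF // sqrtr_gt0 ltr0n muln_gt0 g0.
rewrite mulVf; last by rewrite gt_eqF // sqrtr_gt0 ltr0n muln_gt0 g0.
rewrite mulrAC /c -sqrtrM ?divr_ge0 // natrM.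
have -> : (N%:R / g%:R * (g%:R * N%:R) = N%:R ^+ 2 :> R)%R by field; rewrite gt_eqF.
by rewrite sqrtr_sqr ger0_norm // mulfV // gt_eqF.
Qed.

Lemma acorr_step x : (0 <= x <= 1)%R -> 1 <= acorr step x.
Proof.
move=> /andP[x0 x1]; pose k := Num.floor (N%:R * x).
pose th : R := (N%:R * x - k%:~R)%R.
have /andP[k1 k2] := floor_itv (N%:R * x : R); rewrite -/k in k1 k2.
have th0 : (0 <= th)%R by rewrite subr_ge0.
have th1 : (th < 1)%R by move: k2; rewrite intrD /th; lra.
have k0 : (0 <= k)%R by rewrite floor_ge0 mulr_ge0.
have kN : (k <= N%:Z)%R.
  by rewrite -(ler_int R) (le_trans k1) // ger_pMr.
pose B (d : int) := [seq a <- enum_fset A | (a + d)%R \in A].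
have uB d : uniq (B d) by rewrite filter_uniq // fset_uniq.
have Bg (d : int) : (0 <= d <= N%:Z)%R -> (g <= size (B d))%N.
  have Bp (e : nat) : (1 <= e <= N)%N -> (g <= size (B e%:Z))%N.
    by move=> /AgN /leq_trans; apply; exact: diff_rep_le.
  (* The difference 0 is not in [[N]], but it has at least as many representations as 1. *)
  case: d => // -[|e] /andP[_ eN]; last by apply: Bp.
  apply: leq_trans (Bp 1%N _) _; first by rewrite N0.
  rewrite /B size_filter (leq_trans (count_size _ _)) // size_filter.
  by rewrite (eq_in_count (a2 := predT)) ?count_predT // => a; rewrite addr0 => ->.
(* Translation by [x] moves the part [U a] of the cell [a] into the cell [a + k], and the part [V a]
   into [a + k + 1]. *)
pose U (a : int) : set R := `[(a%:~R / N%:R)%R, ((a%:~R + 1 - th) / N%:R)%R[%classic.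
pose V (a : int) : set R := `[((a%:~R + 1 - th) / N%:R)%R, ((a%:~R + 1) / N%:R)%R[%classic.
have mU a : measurable (U a) by exact: measurable_itv.
have mV a : measurable (V a) by exact: measurable_itv.
have muU a : mu (U a) = ((1 - th) / N%:R)%:E.
  rewrite /U lebesgue_measure_itv /= lte_fin ltr_pM2r ?invr_gt0 //.
  rewrite ifT; last by lra.
  by rewrite -EFinD -mulrBl; congr ((_ / _)%:E); ring.
have muV a : mu (V a) = (th / N%:R)%:E.
  rewrite /V lebesgue_measure_itv /= lte_fin ltr_pM2r ?invr_gt0 //.
  case: ifPn => th'; first by rewrite -EFinD -mulrBl; congr ((_ / _)%:E); ring.
  by have -> : th = 0%R by [lra]; rewrite mul0r.
have UE a t : \1_(U a) t = ((Num.floor (N%:R * t) == a) &&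
    (N%:R * t < (Num.floor (N%:R * t))%:~R + 1 - th)%R)%:R :> R.
  rewrite indicE /U; congr (_%:R); congr nat_of_bool; apply/idP/idP.
    rewrite inE /= in_itv /= ler_pdivrMr // ltr_pdivlMr // (mulrC t).
    move=> /andP[at1 at2].
    have -> : Num.floor (N%:R * t) = a by apply: floor_def; rewrite at1 intrD; lra.
    by rewrite eqxx at2.
  move=> /andP[/eqP <- lt]; rewrite inE /= in_itv /= ler_pdivrMr // ltr_pdivlMr // (mulrC t) lt.
  by rewrite floor_le.
have VE a t : \1_(V a) t = ((Num.floor (N%:R * t) == a) &&
    ~~ (N%:R * t < (Num.floor (N%:R * t))%:~R + 1 - th)%R)%:R :> R.
  rewrite indicE /V; congr (_%:R); congr nat_of_bool; apply/idP/idP.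
    rewrite inE /= in_itv /= ler_pdivrMr // ltr_pdivlMr // (mulrC t).
    move=> /andP[at1 at2].
    have -> : Num.floor (N%:R * t) = a by apply: floor_def; rewrite intrD at2; lra.
    by rewrite eqxx -leNgt.
  rewrite -leNgt => /andP[/eqP <- lt]; rewrite inE /= in_itv /= ler_pdivrMr // ltr_pdivlMr // (mulrC t) lt.
  by have := floorD1_gt (N%:R * t : R); rewrite intrD.
pose F t : R := (\sum_(a <- B k) (c ^+ 2 * \1_(U a) t) +
  \sum_(a <- B (k + 1)) (c ^+ 2 * \1_(V a) t))%R.
apply: (@le_trans _ _ (\int[mu]_t (F t)%:E)); last first.
  apply: ge0_le_integral; [exact: measurableT| | | |].
  - by move=> t _; rewrite lee_fin addr_ge0 // sumr_ge0 // => a _; rewrite mulr_ge0 // sqr_ge0.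
  - apply/measurable_EFinP; apply: measurable_funD; apply: measurable_sum => a.
      by apply: measurable_funM => //; exact: measurable_indicT.
    by apply: measurable_funM => //; exact: measurable_indicT.
  - apply/measurable_EFinP/measurable_funM; first exact: measurable_step.
    by apply: measurableT_comp; [exact: measurable_step|exact: measurable_shift].
  - move=> t _; rewrite lee_fin !stepE mulrACA -expr2 /F -!mulr_sumr -mulrDr ler_wpM2l ?sqr_ge0 //.
    under eq_bigr do rewrite UE.
    under [X in (_ + X)%R]eq_bigr do rewrite VE.
    rewrite !sum_eq_mem // !mem_filter.
    set i := Num.floor (N%:R * t).
    have /andP[i1 i2] := floor_itv (N%:R * t : R); rewrite -/i intrD in i1 i2.
    have -> : Num.floor (N%:R * (x + t)) =
        if (N%:R * t < i%:~R + 1 - th)%R then (i + k)%R else (i + (k + 1))%R.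
      apply: floor_def; rewrite mulrDr !intrD.
      by case: ifPn => H; rewrite !intrD; move: H; rewrite /th; lra.
    rewrite -natrM -natrD ler_nat.
    by case: (_ < _)%R; rewrite /= ?andbT ?andbF ?addn0 ?add0n mulnb andbC; exact: leqnn.
have key (s : seq int) (S : int -> set R) (w : R) : (forall a, measurable (S a)) ->
    (forall a, mu (S a) = w%:E) ->
    \int[mu]_t (\sum_(a <- s) (c ^+ 2 * \1_(S a) t))%R%:E = ((size s)%:R * (c ^+ 2 * w))%:E.
  move=> mS Sw; under eq_integral do rewrite -sumEFin.
  rewrite ge0_integral_sum; [|exact: measurableT| |]; last 2 first.
  - by move=> a; apply/measurable_EFinP; apply: measurable_funM => //; exact: measurable_indicT.
  - by move=> a t _; rewrite lee_fin mulr_ge0 // sqr_ge0.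
  have E a : \int[mu]_t (c ^+ 2 * \1_(S a) t)%:E = (c ^+ 2 * w)%:E.
    under eq_integral do rewrite EFinM.
    rewrite ge0_integralZl_EFin ?sqr_ge0 //; last by apply/measurable_EFinP; exact: measurable_indicT.
    rewrite integral_indic; [|exact: measurableT|exact: mS].
    by rewrite setIT [RHS]EFinM; congr mule; exact: Sw.
  under eq_bigr do rewrite E.
  by rewrite sumEFin big_const_seq count_predT iter_addr_0 mulr_natl.
have F_ge0 (s : seq int) (S : int -> set R) t : setT t ->
    0 <= (\sum_(a <- s) (c ^+ 2 * \1_(S a) t))%R%:E.
  by move=> _; rewrite lee_fin sumr_ge0 // => a _; rewrite mulr_ge0 // sqr_ge0.
have mF (s : seq int) (S : int -> set R) : (forall a, measurable (S a)) ->
    measurable_fun [set: R] (fun t => (\sum_(a <- s) (c ^+ 2 * \1_(S a) t))%R%:E).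
  move=> mS; apply/measurable_EFinP; apply: measurable_sum => a.
  by apply: measurable_funM => //; exact: measurable_indicT.
under eq_integral do rewrite /F EFinD.
rewrite ge0_integralD; [|exact: measurableT|exact: F_ge0|exact: mF|exact: F_ge0|exact: mF].
rewrite (key _ _ _ mU muU) (key _ _ _ mV muV) -EFinD lee_fin.
have gR : (0 < g%:R :> R)%R by rewrite ltr0n.
have cN : (c ^+ 2 / N%:R = g%:R^-1)%R.
  rewrite /c sqr_sqrtr ?divr_ge0 // mulrAC mulfV ?mul1r // gt_eqF //.
have -> : (c ^+ 2 * ((1 - th) / N%:R) = (1 - th) / g%:R)%R by rewrite mulrCA cN.
have -> : (c ^+ 2 * (th / N%:R) = th / g%:R)%R by rewrite mulrCA cN.
rewrite !mulrA -mulrDl ler_pdivlMr // mul1r.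
have Bk : (g%:R <= (size (B k))%:R :> R)%R by rewrite ler_nat Bg // k0 kN.
(* For [k = N] the count at [k + 1] is uncontrolled, but [x <= 1] forces [th = 0], so its weight
   vanishes. *)
have [kltN|] := ltP k N%:Z.
  have Bk1 : (g%:R <= (size (B (k + 1)))%:R :> R)%R by rewrite ler_nat Bg; lia.
  nra.
move=> Nk; have th00 : th = 0%R.
  have kE : k = N%:Z by lia.
  apply/eqP; rewrite eq_le th0 andbT /th kE.
  by rewrite subr_le0 ger_pMr.
by rewrite th00 subr0 mulr1 mulr0 addr0.
Qed.
End lower.

Lemma tau_le_eta (R : realType) (g N : nat) : (0 < g)%N -> (0 < N)%N ->
  (tau R <= ((eta g N)%:R / Num.sqrt (g * N)%:R)%:E)%E.
Proof.
move=> g0 N0; rewrite /eta; case: ex_minnP => n /asboolP[A AgN <-] _.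
rewrite -(@integral_step R A g N g0 N0); apply: ereal_inf_lbound.
have mstep := @measurable_step R A g N.
exists (step A g N); last first.
  apply: ge0_integral_completed; first exact/measurable_EFinP.
  by move=> t; rewrite lee_fin step_ge0.
split; [|by move=> t; exact: step_ge0|].
  exact: (measurableT_comp mstep (@measurable_lebesgueR_id R)).
move=> x; rewrite in_itv /= => x01; rewrite autocorrE //; last by move=> t; exact: step_ge0.
exact: acorr_step.
Qed.

(** * The two limits *)

(** Scaling the window masses by [rho] and rounding gives the levels for [eta_parabola]. The first
    summand is the parabola set, with a rounding loss of 2 per level; the second is the grid. *)
Lemma eta_bound (R : realType) (r e H K g N s : nat) (C D : nat -> R) (I rho : R) :
  prime r -> odd r -> (0 < e)%N -> (0 < g)%N -> (0 < N)%N ->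
  (N < r ^ e * r ^ e * K.+1)%N -> 0 <= rho ->
  (forall p, [/\ 0 <= D p, D p <= C p, D p <= C p.+1 & C p <= I]) ->
  (forall n, \sum_(p < n) C p <= s.+1%:R * I) ->
  rho * I + 2 <= (r ^ e)%:R ->
  (forall k, (k <= K)%N -> g%:R <= rho ^+ 2 * \sum_(p < H) C p * D (p + k)%N) ->
  (eta g N)%:R <= (r ^ e)%:R * (rho * (s.+1%:R * I) + 2 * (H + K + 2)%:R) +
    (2 * Num.sqrt (g * N)%:R / Num.sqrt r%:R + (2 * g + 1)%:R).
Proof.
move=> rP ro e0 g0 N0 NK rho0 CD sumC rhoP Hg.
have C0 p : 0 <= C p by have [D0 DC _ _] := CD p; apply: le_trans D0 DC.
(* Padded so that no level [j + k + 1] with [j < H] and [k <= K] is cut to 0. *)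
pose H' := (H + K + 2)%N.
(* The spare unit in [rho * C p + 1 <= n p] absorbs the [.-1] due to carries. *)
pose n (p : nat) := if (p < H')%N then (Num.trunc (rho * C p)).+2 else 0%N.
have n_lb p : (p < H')%N -> rho * C p + 1 <= (n p)%:R.
  move=> pH; rewrite /n pH -[in leRHS]addn1 natrD lerD2r.
  by have /andP[_ /ltW] := truncn_itv (mulr_ge0 rho0 (C0 p)).
have n_ub p : (n p)%:R <= rho * C p + 2.
  rewrite /n; case: ifP => _; last by rewrite addr_ge0 // mulr_ge0.
  rewrite -addn2 natrD lerD2r.
  by have /andP[] := truncn_itv (mulr_ge0 rho0 (C0 p)).
(* [al] balances the two parts of the grid: [g * al = N / (r * al) = sqrt (g * N / r)]. *)
pose al : R := Num.sqrt (N%:R / (g%:R * r%:R)).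
pose a := (Num.trunc al).+1.
have r0 : 0 < r%:R :> R by rewrite ltr0n prime_gt0.
have gR : 0 < g%:R :> R by rewrite ltr0n.
have NR : 0 < N%:R :> R by rewrite ltr0n.
have al0 : 0 < al by rewrite sqrtr_gt0 divr_gt0 // mulr_gt0.
have /andP[al1 al2] := truncn_itv (ltW al0).
have := @eta_parabola r e H' K g N a n rP ro e0 _ _ isT NK _.
move=> /(_ _ _ _)/wrap[].
- move=> j; rewrite -(ler_nat R) (le_trans (n_ub j)) // (le_trans _ rhoP) // lerD2r.
  by rewrite ler_wpM2l //; have [] := CD j.
- by move=> j jH; rewrite /n ltnNge jH.
- move=> k kK; rewrite -(ler_nat R) (le_trans (Hg k kK)) //.
  rewrite natr_sum mulr_sumr.
  rewrite (big_ord_widen H' (fun p => rho ^+ 2 * (C p * D (p + k)%N))); last first.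
    by rewrite /H' -addnA leq_addr.
  rewrite big_mkcond /=; apply: ler_sum => j _; case: ifP => // jH.
  have [D0 DC DC1 _] := CD (j + k)%N.
  have jk1 : (j + k + 1 < H')%N by move: (nat_of_ord j) jH kK => i; rewrite /H'; clear; lia.
  have jk : (j + k < H')%N by apply: leq_ltn_trans jk1; rewrite leq_addr.
  rewrite natrM expr2 mulrACA; apply: ler_pM; rewrite ?mulr_ge0 //.
    by apply: le_trans (n_lb j _); rewrite ?lerDl //.
  have Dn i : (i < H')%N -> D (j + k)%N <= C i -> rho * D (j + k)%N + 1 <= (n i)%:R.
    by move=> iH DCi; apply: le_trans (n_lb i iH); rewrite lerD2r ler_wpM2l.
  have : rho * D (j + k)%N + 1 <= (minn (n (j + k)%N) (n (j + k + 1)%N))%:R.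
    by rewrite /minn; case: ifP => _; apply: Dn; rewrite // addn1.
  case: (minn _ _) => [|w]; last by rewrite -[in leRHS]addn1 natrD lerD2r.
  by rewrite /= => ?; lra.
rewrite -(ler_nat R) => /le_trans; apply; rewrite natrD; apply: lerD.
  rewrite natrM ler_wpM2l // natr_sum.
  apply: (@le_trans _ _ (\sum_(p < H') (rho * C p + 2))); first by apply: ler_sum => p _.
  rewrite big_split /= -mulr_sumr sumr_const card_ord mulr_natr lerD2r ler_wpM2l //.
  exact: sumC.
pose q := g%:R * al.
have alE : al ^+ 2 * (g%:R * r%:R) = N%:R.
  by rewrite sqr_sqrtr ?mulfVK ?mulf_neq0 ?gt_eqF // ltW // divr_gt0 // mulr_gt0.
have -> : 2 * Num.sqrt (g * N)%:R / Num.sqrt r%:R = 2 * q.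
  rewrite -mulrA; congr (_ * _); apply: (@mulIf _ (Num.sqrt r%:R)).
    by rewrite gt_eqF // sqrtr_gt0.
  rewrite mulfVK ?gt_eqF ?sqrtr_gt0 // natrM -alE.
  have -> : g%:R * (al ^+ 2 * (g%:R * r%:R)) = q ^+ 2 * r%:R by rewrite /q; ring.
  by rewrite sqrtrM ?sqr_ge0 // sqrtr_sqr ger0_norm // mulr_ge0 // ltW.
have ga : g%:R * a%:R <= q + g%:R.
  by rewrite /q -[X in _ + X]mulr1 -mulrDr ler_wpM2l // /a -addn1 natrD lerD2r.
have Na : (N %/ r %/ a)%:R <= q.
  apply: (@le_trans _ _ (N%:R / (r%:R * al))); last first.
    rewrite ler_pdivrMr ?mulr_gt0 // -alE /q.
    by have -> : g%:R * al * (r%:R * al) = al ^+ 2 * (g%:R * r%:R) by ring.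
  rewrite ler_pdivlMr ?mulr_gt0 //.
  apply: (@le_trans _ _ ((N %/ r %/ a) * (r * a))%:R).
    by rewrite natrM ler_wpM2l // natrM ler_wpM2l // ltW.
  rewrite ler_nat -divnMA; exact: leq_trunc_div.
rewrite !natrD !natrM; lra.
Qed.

Lemma le_sqrtr (R : rcfType) (x y : R) : 0 <= x -> x ^+ 2 <= y -> x <= Num.sqrt y.
Proof. by move=> x0 xy; rewrite -[x]ger0_norm // -sqrtr_sqr ler_wsqrtr. Qed.

(* Order of the choices: d, s, m0 and r depend on eps and I only; Hm bounds the number of
   blocks for every K < r ^ 2 * m0; then g is large with respect to Hm, and N with
   respect to g. *)
Lemma eta_upper (R : realType) (f : R -> R) (I eps : R) :
  measurable_fun [set: R] f -> (forall x, 0 <= f x) ->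
  (forall x : R, 0 <= x <= 1 -> (1 <= acorr f x)%E) ->
  (\int[@lebesgue_measure R]_x (f x)%:E = I%:E)%E -> 0 < eps ->
  \forall g \near \oo, \forall N \near \oo,
    (eta g N)%:R <= (I + eps) * Num.sqrt (g * N)%:R.
Proof.
move=> mf f0 f1 fI e0.
have I0 : 0 <= I by rewrite -lee_fin -fI; apply: integral_ge0 => x _; rewrite lee_fin.
(* One factor [1 + d] in [dI] is spent on [rho], the other on [s.+1 / s]. *)
pose d : R := Num.min 1 (eps / (12 * (I + 1))).
have I1 : 0 < 12 * (I + 1) by lra.
have d0 : 0 < d by rewrite lt_min ltr01 divr_gt0.
have d1 : d <= 1 by rewrite ge_min lexx.
have dI : I * (1 + d) ^+ 2 <= I + eps / 4.
  have : d * (12 * (I + 1)) <= eps by rewrite -ler_pdivlMr // ge_min lexx orbT.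
  nra.
pose s := (Num.trunc (d^-1)).+1.
have ds : d^-1 <= s%:R.
  by have /andP[_ /ltW] := truncn_itv (ltW (etrans (invr_gt0 d) d0)).
have s0 : 0 < s%:R :> R by rewrite ltr0n.
(* For every [K >= m0] this gives [K + s <= (1 + d) * K]. *)
pose m0 := (Num.trunc (s%:R / d)).+1.
have dm0 : s%:R <= d * m0%:R.
  rewrite mulrC -ler_pdivrMr //.
  by have /andP[_ /ltW] := truncn_itv (ltW (divr_gt0 s0 d0)).
(* The bound [(8 / eps) ^ 2] brings the main cost of the grid down to an [eps / 4] share; [r > 2]
   makes [r] odd. *)
have [r r_gt rP] := prime_above (maxn 2 (Num.trunc ((8 / eps) ^+ 2)).+1).
have ro : odd r.
  by case: (even_prime rP) => // r2; move: r_gt; rewrite r2 gtn_max ltnn.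
have rE : 2 / Num.sqrt r%:R <= eps / 4.
  have r0 : 0 < Num.sqrt r%:R :> R by rewrite sqrtr_gt0 ltr0n prime_gt0.
  have : 8 / eps <= Num.sqrt r%:R.
    apply: le_sqrtr; first by rewrite divr_ge0 // ltW.
    have /andP[_ /ltW/le_trans] := truncn_itv (sqr_ge0 (8 / eps)); apply.
    by rewrite ler_nat ltnW // (leq_trans _ r_gt) // ltnS leq_maxr.
  by rewrite ler_pdivrMr // ler_pdivrMr // => ?; lra.
(* The mesh [1 / (K + s)] admits every shift [k <= K]. *)
have disc K : exists HCD : nat * (nat -> R) * (nat -> R),
  [/\ forall p, [/\ 0 <= HCD.2 p, HCD.2 p <= HCD.1.2 p, HCD.2 p <= HCD.1.2 p.+1 &
        HCD.1.2 p <= I]%R,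
      forall n, (\sum_(p < n) HCD.1.2 p <= s.+1%:R * I)%R &
      forall k, (k <= K)%N ->
        ((1 - d / 4) * s%:R ^+ 2 / (K + s)%:R <=
         \sum_(p < HCD.1.1) HCD.1.2 p * HCD.2 (p + k)%N)%R].
  have m_gt0 : (0 < K + s)%N by rewrite addn_gt0 orbT.
  have d4 : 0 < d / 4 by rewrite divr_gt0.
  have [H [C [D [CD sC Hk]]]] := discretization mf f0 m_gt0 f1 fI (leq_addl K s) d4.
  by exists (H, C, D); split => // k kK; apply: Hk; rewrite leq_add2r.
have [HCD hHCD] := choice disc.
pose M := (r ^ 2 * m0)%N.
pose Hm := (\max_(K < M) ((HCD K).1.1 + K + 2))%N.
near=> g.
have g_gt0 : (0 < g)%N by near: g; exact: nbhs_infty_gt.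
have gH : 2 * Hm%:R <= eps / 4 * Num.sqrt g%:R.
  have : 8 * Hm%:R / eps <= Num.sqrt g%:R.
    apply: le_sqrtr; first by rewrite divr_ge0 ?mulr_ge0 // ltW.
    by near: g; exact: nbhs_infty_ger.
  by rewrite ler_pdivrMr // => ?; lra.
(* Threshold for [P]: since [rho <= 2 * sqrt (g * M)], [Pm <= P] yields [rho * I + 2 <= P]; and
   [Pm >= 2] excludes [e = 0]. *)
pose Pm := (Num.trunc (2 * Num.sqrt (g * M)%:R * I + 2)).+2.
near=> N.
have N_gt0 : (0 < N)%N by near: N; exact: nbhs_infty_gt.
have NPm : ((r * Pm) ^ 2 * m0 <= N)%N by near: N; exact: nbhs_infty_ge.
have gN : (2 * g + 1)%:R <= eps / 4 * Num.sqrt (g * N)%:R.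
  have : 4 * (2 * g + 1)%:R / eps <= Num.sqrt (g * N)%:R.
    apply: le_sqrtr; first by rewrite divr_ge0 ?mulr_ge0 // ltW.
    apply: (@le_trans _ _ N%:R); last by rewrite ler_nat leq_pmull.
    by near: N; exact: nbhs_infty_ger.
  by rewrite ler_pdivrMr // => ?; lra.
have r_gt1 := prime_gt1 rP.
have r_gt0 := prime_gt0 rP.
(* The largest [e] with [(r ^ e) ^ 2 * m0 <= N], whence [m0 <= K < r ^ 2 * m0] below. *)
pose e := trunc_log (r ^ 2) (N %/ m0).
have [e1 e2] : ((r ^ e) ^ 2 * m0 <= N)%N /\ (N < (r ^ e.+1) ^ 2 * m0)%N.
  have Nm : (0 < N %/ m0)%N.
    rewrite divn_gt0 // (leq_trans _ NPm) // leq_pmull // expn_gt0 muln_gt0 r_gt0 //.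
  have r2 : (1 < r ^ 2)%N by rewrite -(exp1n 2) ltn_exp2r.
  have /andP[e1 e2] := trunc_log_bounds r2 Nm; split.
    by rewrite -leq_divRL // -expnM mulnC expnM.
  by rewrite -ltn_divLR // -expnM mulnC expnM.
have PmP : (Pm <= r ^ e)%N.
  rewrite leqNgt; apply/negP => ePm; move: e2; rewrite ltnNge => /negP; apply.
  apply: leq_trans NPm; rewrite leq_mul2r leq_exp2r // (expnS r e) leq_mul2l (ltnW ePm).
  by rewrite !orbT.
have e_gt0 : (0 < e)%N.
  by move: PmP; case: (e) => //; rewrite expn0.
pose P := (r ^ e)%N.
have P_gt0 : (0 < P)%N by rewrite expn_gt0 r_gt0.
pose K := (N %/ (P * P))%N.
have K1 : (m0 <= K)%N.
  by rewrite /K leq_divRL ?muln_gt0 ?P_gt0 // mulnC mulnn.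
have K2 : (K < M)%N.
  rewrite /K ltn_divLR ?muln_gt0 ?P_gt0 // (leq_trans e2) // (expnS r e) expnMn /M -/P mulnn.
  by rewrite mulnAC.
pose S : R := Num.sqrt (g * N)%:R.
(* At this scale [rho ^+ 2] times the correlation bound reaches [g], because
   [(1 + d) ^ 2 * (1 - d / 4) >= 1 + d] and [K + s <= (1 + d) * K]. *)
pose rho : R := (1 + d) * Num.sqrt (g * K)%:R / s%:R.
have [CD sC Hk] := hHCD K.
have PS : P%:R * Num.sqrt (g * K)%:R <= S.
  rewrite -[P%:R]ger0_norm // -sqrtr_sqr -sqrtrM ?sqr_ge0 // ler_wsqrtr //.
  rewrite -natrX -natrM ler_nat mulnCA leq_mul2l mulnC -mulnn leq_trunc_div orbT //.
have rho0 : 0 <= rho by rewrite divr_ge0 // mulr_ge0 ?sqrtr_ge0 // addr_ge0 // ltW.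
have s1 : 1 <= s%:R :> R by rewrite ler1n.
have dK : s%:R <= d * K%:R.
  by apply: le_trans dm0 _; rewrite ler_wpM2l ?(ltW d0) // ler_nat.
have K0 : 0 <= K%:R :> R by [].
have gR : 0 < g%:R :> R by rewrite ltr0n.
have d4 : 1 + d <= (1 + d) ^+ 2 * (1 - d / 4) by nra.
apply: le_trans (@eta_bound R r e (HCD K).1.1 K g N s _ _ I rho rP ro
  e_gt0 g_gt0 N_gt0 _ rho0 CD sC _ _) _.
- by rewrite mulnC ltn_ceil // muln_gt0 P_gt0.
- apply: (@le_trans _ _ Pm%:R); last by rewrite ler_nat.
  apply: (@le_trans _ _ (2 * Num.sqrt (g * M)%:R * I + 2)); last first.
    have x0 : 0 <= 2 * Num.sqrt (g * M)%:R * I + 2.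
      by rewrite addr_ge0 // !mulr_ge0 // sqrtr_ge0.
    have /andP[_ /ltW/le_trans] := truncn_itv x0; apply.
    by rewrite ler_nat.
  rewrite lerD2r ler_wpM2r // /rho ler_pdivrMr //.
  apply: (@le_trans _ _ (2 * Num.sqrt (g * M)%:R)); last first.
    by rewrite ler_peMr // mulr_ge0 // sqrtr_ge0.
  apply: ler_pM; rewrite ?sqrtr_ge0 //; [lra|lra|].
  by rewrite ler_wsqrtr // ler_nat leq_mul2l (ltnW K2) orbT.
- move=> k kK.
  apply: (@le_trans _ _ (rho ^+ 2 * ((1 - d / 4) * s%:R ^+ 2 / (K + s)%:R))); last first.
    by rewrite ler_wpM2l ?sqr_ge0 // Hk.
  have KsR : 0 < (K + s)%:R :> R by rewrite ltr0n addn_gt0 orbT.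
  rewrite mulrA ler_pdivlMr // /rho.
  have -> : ((1 + d) * Num.sqrt (g * K)%:R / s%:R) ^+ 2 * ((1 - d / 4) * s%:R ^+ 2) =
     (1 + d) ^+ 2 * (1 - d / 4) * Num.sqrt (g * K)%:R ^+ 2.
    by field; rewrite gt_eqF.
  rewrite sqr_sqrtr // natrM natrD mulrCA ler_pM2l //.
  nra.
have KH : ((HCD K).1.1 + K + 2 <= Hm)%N.
  exact: (@leq_bigmax _ (fun K : 'I_M => (HCD K).1.1 + K + 2)%N (Ordinal K2)).
have S0 : 0 <= S by exact: sqrtr_ge0.
have PsS : P%:R * Num.sqrt g%:R <= S.
  apply: le_trans PS; rewrite ler_wpM2l // ler_wsqrtr // ler_nat leq_pmulr //.
  exact: leq_trans K1.
have t1 : P%:R * (rho * (s.+1%:R * I)) <= (I + eps / 4) * S.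
  have -> : P%:R * (rho * (s.+1%:R * I)) =
      (P%:R * Num.sqrt (g * K)%:R) * (I * ((1 + d) * (1 + s%:R^-1))).
    by rewrite /rho -addn1 natrD; field; rewrite gt_eqF.
  have sd : s%:R^-1 <= d by rewrite -[d]invrK lef_pV2 ?posrE ?invr_gt0.
  apply: (@le_trans _ _ (S * (I * ((1 + d) * (1 + s%:R^-1))))).
    rewrite ler_wpM2r // !mulr_ge0 ?addr_ge0 ?invr_ge0 // ltW //.
  rewrite mulrC ler_wpM2r // (le_trans _ dI) // expr2.
  by rewrite !ler_wpM2l ?lerD2l // addr_ge0 // ltW.
have t2 : P%:R * (2 * ((HCD K).1.1 + K + 2)%:R) <= eps / 4 * S.
  apply: (@le_trans _ _ (P%:R * (eps / 4 * Num.sqrt g%:R))).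
    by rewrite ler_wpM2l // (le_trans _ gH) // ler_pM2l // ler_nat.
  by rewrite mulrCA ler_wpM2l // divr_ge0 // ltW.
have t3 : 2 * S / Num.sqrt r%:R <= eps / 4 * S.
  by rewrite mulrAC ler_wpM2r.
(* Four shares of [eps / 4]: main term, rounding of levels, and the two parts of the grid cost. *)
rewrite -/P -/S in gN *; lra.
Unshelve. all: by end_near.
Qed.

Section limits.
Variable R : realType.
Local Open Scope ereal_scope.

Lemma limn_esup_le_near (u : (\bar R)^nat) (M : \bar R) :
  (\forall n \near \oo, u n <= M) -> limn_esup u <= M.
Proof.
move=> [n0 _ Hn]; rewrite limn_esup_lim; apply: lime_le; first exact: is_cvg_esups.
exists n0 => // n /= n0n; apply: ge_ereal_sup => _ [k /= nk <-].
by apply: Hn; apply: leq_trans nk.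
Qed.

Lemma limn_einf_ge_near (u : (\bar R)^nat) (M : \bar R) :
  (\forall n \near \oo, M <= u n) -> M <= limn_einf u.
Proof.
move=> [n0 _ Hn]; rewrite limn_einf_lim; apply: lime_ge; first exact: is_cvg_einfs.
exists n0 => // n /= n0n; apply: le_ereal_inf_tmp => _ [k /= nk <-].
by apply: Hn; apply: leq_trans nk.
Qed.

Lemma cvge_squeeze_eps (v : (\bar R)^nat) (T : R) :
  (forall e : R, (0 < e)%R -> \forall n \near \oo, T%:E <= v n <= (T + e)%:E) ->
  v @ \oo --> T%:E.
Proof.
move=> H; apply/fine_cvgP; split.
  have := H _ ltr01; apply: filterS => n.
  by case: (v n) => [x| |] /andP[]; [by []|by rewrite leye_eq|by rewrite leeNy_eq].
apply/cvgrPdist_le => e e0; have := H _ e0; apply: filterS => n /=.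
case: (v n) => [x| |] /andP[]; [|by rewrite leye_eq|by rewrite leeNy_eq].
by rewrite !lee_fin /= => x1 x2; rewrite ler0_norm; lra.
Qed.

Lemma tau_fin_num : tau R \is a fin_num.
Proof.
(* The case [g = N = 1] of [tau_le_eta] bounds [tau] above. *)
rewrite ge0_fin_numE; first exact: le_lt_trans (tau_le_eta R (ltn0Sn 0) (ltn0Sn 0)) (ltry _).
apply: le_ereal_inf_tmp => _ [f [_ f0 _] <-].
by apply: integral_ge0 => x _; rewrite lee_fin.
Qed.

Lemma eta_le_tau (e : R) : (0 < e)%R -> \forall g \near \oo, \forall N \near \oo,
  ((eta g N)%:R / Num.sqrt (g * N)%:R)%:E <= tau R + e%:E.
Proof.
move=> e0; have e20 : (0 < e / 2)%R by rewrite divr_gt0.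
(* Half of [e] pays for a near-minimizer, half for [eta_upper]. *)
have [_ [f fF <-] fe] := lb_ereal_inf_adherent e20 tau_fin_num.
have [h [mh h0 h1 hf]] := autocorr_class_Borel fF.
rewrite -/(tau R) in fe.
have hlt := le_lt_trans hf fe.
have hfin : \int[@lebesgue_measure R]_x (h x)%:E \is a fin_num.
  rewrite ge0_fin_numE; last by apply: integral_ge0 => x _; rewrite lee_fin.
  by apply: lt_trans hlt _; rewrite -(fineK tau_fin_num) -EFinD ltry.
have := eta_upper mh h0 h1 (esym (fineK hfin)) e20.
rewrite -(fineK tau_fin_num) -(fineK hfin) -EFinD lte_fin in hlt.
rewrite -[tau R](fineK tau_fin_num).
move: (fine (tau R)) (fine (\int[_]_x _)) hlt => T I hlt.
apply: filter_app; near=> g; apply: filter_app; near=> N.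
have S0 : (0 < Num.sqrt (g * N)%:R :> R)%R.
  rewrite sqrtr_gt0 ltr0n muln_gt0; apply/andP; split.
    by near: g; exact: nbhs_infty_gt.
  by near: N; exact: nbhs_infty_gt.
move=> /le_trans H; rewrite -EFinD lee_fin ler_pdivrMr //; apply: H.
by rewrite ler_wpM2r ?(ltW S0) //; lra.
Unshelve. all: by end_near.
Qed.
End limits.

Theorem mainTheorem1 (R : realType) :
  (limn_einf (fun N : nat => ((eta g N)%:R / Num.sqrt (g * N)%:R)%:E)
     @[g --> \oo] --> tau R) /\
  (limn_esup (fun N : nat => ((eta g N)%:R / Num.sqrt (g * N)%:R)%:E)
     @[g --> \oo] --> tau R).
Proof.
pose u (g N : nat) : \bar R := ((eta g N)%:R / Num.sqrt (g * N)%:R)%:E.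
(* As the lower limit is at most the upper one, these two bounds squeeze both. *)
have bounds (e : R) : 0 < e -> \forall g \near \oo,
    ((tau R <= limn_einf (u g)) && (limn_esup (u g) <= tau R + e%:E))%E.
  move=> e0; near=> g; apply/andP; split.
    apply: limn_einf_ge_near; exists 1%N => // N /= N0; apply: tau_le_eta => //.
    by near: g; exact: nbhs_infty_gt.
  by apply: limn_esup_le_near; near: g; exact: eta_le_tau.
rewrite -(fineK (tau_fin_num R)) in bounds *.
split; apply: cvge_squeeze_eps => e /bounds; apply: filterS => g /andP[h1 h2].
  by rewrite h1 (le_trans (limn_einf_sup _)).
by rewrite h2 andbT (le_trans h1) // limn_einf_sup.
Unshelve. all: by end_near.
Qed.
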